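(* Let $G$ be a finite simple $r$-regular graph with $r\in\{2,3,4,5\}$. Then $G$ is of class one.
   Context: $\beta(G)$ is the size of a minimum vertex cover. Alcuin problem: the vertices of $G$ are items initially on the left bank of a river; a man with a boat of capacity $b$ (a positive integer) must carry them all to the right bank so that no two adjacent vertices are ever left together on a bank. Formally, a feasible schedule for capacity $b$ is a sequence of triples $(L_k,B_k,R_k)$, $k=1,\dots,s$, $s$ odd, such that: each triple is a partition of $V$; $L_k$ and $R_k$ are independent sets; $|B_k|\le b$; $L_1\cup B_1=V$; $B_s\cup R_s=V$; for even $k$, $L_k=L_{k-1}$ and $B_k\cup R_k=B_{k-1}\cup R_{k-1}$; for odd $k\ge 3$, $R_k=R_{k-1}$ and $B_k\cup L_k=B_{k-1}\cup L_{k-1}$. The Alcuin number $c(G)$ is the least positive integer $b$ for which a feasible schedule exists. One always has $\beta(G)\le c(G)\le \beta(G)+1$; $G$ is of class one if $c(G)=\beta(G)$ and of class two if $c(G)=\beta(G)+1$. *)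

(* Defs.v *)
From mathcomp Require Import all_boot.
From mathcomp Require Import boolp.

Set Implicit Arguments.
Unset Strict Implicit.
Unset Printing Implicit Defensive.

(* A finite simple graph is a symmetric and irreflexive [e : rel T] over a
   finType [T] of vertices. *)

Definition regular (T : finType) (e : rel T) (r : nat) : Prop :=
  forall x : T, #|[set y | e x y]| = r.

Definition independent (T : finType) (e : rel T) (S : {set T}) : bool :=
  [forall x in S, forall y in S, ~~ e x y].

Definition vertex_cover (T : finType) (e : rel T) (S : {set T}) : bool :=
  [forall x, forall y, e x y ==> (x \in S) || (y \in S)].

Definition vertex_cover_number (T : finType) (e : rel T) : nat :=
  #|[arg min_(S < [set: T] | vertex_cover e S) #|S| ]|.

(* Blocks may be empty, so this is not [finset.partition]. *)
Definition tripartition (T : finType) (L B R : {set T}) : Prop :=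
  [/\ L :|: B :|: R = [set: T],
      [disjoint L & B], [disjoint L & R] & [disjoint B & R]].

(* The schedule is (L k, B k, R k) for k = 1, ..., s; values of L, B, R at
   other indices are irrelevant. *)
Definition feasible_schedule (T : finType) (e : rel T) (b s : nat)
    (L B R : nat -> {set T}) : Prop :=
  [/\ odd s,
      forall k, 1 <= k <= s ->
        [/\ tripartition (L k) (B k) (R k),
            independent e (L k), independent e (R k) & #|B k| <= b],
      L 1 :|: B 1 = [set: T] /\ B s :|: R s = [set: T],
      forall k, 2 <= k <= s -> ~~ odd k ->
        L k = L k.-1 /\ B k :|: R k = B k.-1 :|: R k.-1
    & forall k, 3 <= k <= s -> odd k ->
        R k = R k.-1 /\ B k :|: L k = B k.-1 :|: L k.-1].

Definition schedulable (T : finType) (e : rel T) (b : nat) : Prop :=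
  exists (s : nat) (L B R : nat -> {set T}), feasible_schedule e b s L B R.

Lemma schedulable_ex (T : finType) (e : rel T) :
  exists b, (0 < b) && `[< schedulable e b >].
Proof.
exists #|T|.+1; apply/asboolP.
exists 1, (fun=> set0), (fun=> [set: T]), (fun=> set0).
have ind0 : independent e set0 by apply/forall_inP => x; rewrite inE.
split=> //.
- move=> k _; split=> //; last by rewrite cardsT leqnSn.
  split; first by rewrite set0U setU0.
  + by rewrite disjoints_subset sub0set.
  + by rewrite disjoints_subset sub0set.
  + by rewrite disjoints_subset setC0 subsetT.
- by rewrite set0U setU0.
Qed.

Definition alcuin_number (T : finType) (e : rel T) : nat :=
  ex_minn (schedulable_ex e).

Definition class_one (T : finType) (e : rel T) : Prop :=
  alcuin_number e = vertex_cover_number e.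

(* Main.v *)
(** Let [Y] be a minimum vertex cover and [X] its (independent) complement.
    Whenever [S] is a nonempty independent subset of [Y] having at most
    [2 * #|S|] neighbours in [X], capacity [#|Y|] suffices: put [S] on the right
    bank, ferry the vertices of [X] without neighbour in [S] one by one, ferry at
    most [#|S|] of the remaining ones in the places of [S] on the boat, take [S]
    back to the left bank in exchange, ferry the rest of [X], and fetch [S].
    If some [y] in [Y] has at most 2 neighbours in [X], take [S = [set y]].
    Otherwise every [y] in [Y] has [d y >= 3] neighbours in [X], hence only
    [r - d y] in [Y]. Greedily choosing vertices of maximal [d] yields an
    independent [S] with [\sum_(y in Y) d y <= 2 * r * #|S|], because
    [d * (1 + r - d) <= 2 * r] for [3 <= d <= r <= 5]. The sum is [r * #|X|],
    so [#|X| <= 2 * #|S|]. *)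

Require Import Defs.
From mathcomp Require Import all_boot.
From mathcomp Require Import boolp zify.

Set Implicit Arguments.
Unset Strict Implicit.
Unset Printing Implicit Defensive.

(** * Independent sets and vertex covers *)

Lemma independentP (T : finType) (e : rel T) (S : {set T}) :
  reflect {in S &, forall x y, ~~ e x y} (independent e S).
Proof.
apply: (iffP forall_inP) => [h x y xS yS|h x xS].
  by have /forall_inP := h x xS; apply.
by apply/forall_inP => y yS; apply: h.
Qed.

Lemma independentS (T : finType) (e : rel T) (A B : {set T}) :
  A \subset B -> independent e B -> independent e A.
Proof.
move=> /subsetP AB /independentP iB; apply/independentP => x y xA yA.
by apply: iB; apply: AB.
Qed.

Lemma independent0 (T : finType) (e : rel T) : independent e set0.
Proof. by apply/independentP => x y; rewrite inE. Qed.

Lemma disjoint_setUl (T : finType) (A B C : {set T}) :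
  [disjoint A :|: B & C] = [disjoint A & C] && [disjoint B & C].
Proof. by rewrite !disjoints_subset subUset. Qed.

Lemma vertex_coverC (T : finType) (e : rel T) (Y : {set T}) :
  vertex_cover e Y = independent e (~: Y).
Proof.
apply/forallP/independentP => [h x y|h x].
  rewrite !inE => /negbTE xY /negbTE yY; apply/negP => exy.
  by have /forallP/(_ y) := h x; rewrite exy xY yY.
apply/forallP => y; apply/implyP; apply: contraLR; rewrite negb_or => /andP[xY yY].
by apply: h; rewrite inE.
Qed.

Lemma vertex_cover_numberP (T : finType) (e : rel T) :
  exists2 Y, vertex_cover e Y /\ #|Y| = vertex_cover_number e &
    forall Z, vertex_cover e Z -> vertex_cover_number e <= #|Z|.
Proof.
rewrite /vertex_cover_number; case: arg_minnP => [|Y cY minY].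
  by rewrite vertex_coverC setCT independent0.
by exists Y.
Qed.

(** The complement of the independent set [L 1] is a vertex cover, and all of it is on the boat
    during the first crossing. *)
Lemma schedulable_cover (T : finType) (e : rel T) b :
  schedulable e b -> vertex_cover_number e <= b.
Proof.
move=> [s [L [B [R [s_odd val [LB1 _] _ _]]]]].
have [|_ iL _ cB] := val 1; first by case: s s_odd {val LB1}.
have [Y _ minY] := vertex_cover_numberP e.
apply: leq_trans cB; apply: minY.
rewrite vertex_coverC; apply: independentS iL; apply/subsetP => x.
have : x \in L 1 :|: B 1 by rewrite LB1.
by rewrite !inE; case: (x \in B 1) => //; rewrite orbF.
Qed.

(** * Schedules described by the contents of the two banks *)

Definition banks_ok (T : finType) (e : rel T) b (L R : {set T}) : bool :=
  [&& [disjoint L & R], independent e L, independent e R & #|~: (L :|: R)| <= b].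

(* The boat is at the left bank; as the three blocks partition the vertex set,
   the contents of the two banks determine the load of the boat. *)
Definition reachable (T : finType) (e : rel T) b (L0 R0 : {set T}) : Prop :=
  exists (s : nat) (L R : nat -> {set T}),
    [/\ odd s, forall k, 1 <= k <= s -> banks_ok e b (L k) (R k), R 1 = set0,
        L s = L0 /\ R s = R0 &
        forall k, 2 <= k <= s -> if odd k then R k = R k.-1 else L k = L k.-1].

Lemma reachable_start (T : finType) (e : rel T) b (X : {set T}) :
  banks_ok e b X set0 -> reachable e b X set0.
Proof.
move=> ok; exists 1, (fun=> X), (fun=> set0); split=> // k; lia.
Qed.

(** A round trip appends the states [(L, R')] and [(L', R')]. Since one bank is unchanged, the
    intermediate state is either the final or the initial one, so only the final state has to be
    checked. *)
Lemma reachable_step (T : finType) (e : rel T) b (L L' R R' : {set T}) :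
  reachable e b L R -> banks_ok e b L' R' -> L' = L \/ R' = R ->
  reachable e b L' R'.
Proof.
move=> [s [Lk [Rk [s_odd ok R1 [Ls Rs] tr]]]] ok' eqLR.
have s_gt0 : 0 < s by case: (s) s_odd.
have okLR' : banks_ok e b L R'.
  case: eqLR => [<- //|->]; rewrite -Ls -Rs; apply: ok; lia.
exists s.+2, (fun k => if k <= s then Lk k else if k == s.+1 then L else L').
exists (fun k => if k <= s then Rk k else R').
split.
- by rewrite /= negbK.
- move=> k /andP[k1 ks]; case: leqP => [le|lt]; first by apply: ok; rewrite k1.
  by case: eqP.
- by rewrite s_gt0.
- rewrite ltnNge leqnSn /=.
  by rewrite gtn_eqF.
- move=> k /andP[k2 ks]; case: (leqP k s) => [le|lt].
    have -> : k.-1 <= s by lia.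
    by apply: tr; rewrite k2.
  have [->|ne] := eqVneq k s.+1; first by rewrite /= s_odd leqnn Ls.
  have -> : k = s.+2 by lia.
  by rewrite /= s_odd /= ltnn.
Qed.

(** With the load defined as the complement of both banks, the boat and one bank together form the
    complement of the other bank; a fixed bank therefore yields the required conservation law. *)
Lemma reachable_schedulable (T : finType) (e : rel T) b (R : {set T}) :
  reachable e b set0 R -> schedulable e b.
Proof.
move=> [s [L [Rk [s_odd ok R1 [Ls Rs] tr]]]].
have BR k : 1 <= k <= s -> ~: (L k :|: Rk k) :|: Rk k = ~: L k.
  move=> /ok /and4P[dj _ _ _]; apply/setP => x; rewrite !inE.
  have [xL|_] := boolP (x \in L k); first by rewrite (disjointFr dj xL).
  by case: (x \in Rk k).
have BL k : 1 <= k <= s -> ~: (L k :|: Rk k) :|: L k = ~: Rk k.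
  move=> /ok /and4P[dj _ _ _]; apply/setP => x; rewrite !inE.
  have [xR|_] := boolP (x \in Rk k); first by rewrite (disjointFl dj xR).
  by case: (x \in L k).
exists s, L, (fun k => ~: (L k :|: Rk k)), Rk; split=> //.
- move=> k /ok /and4P[dj iL iR cB]; split=> //; split=> //.
  + by rewrite setUAC setUCr.
  + by rewrite disjoints_subset setCK subsetUl.
  + by rewrite disjoint_sym disjoints_subset setCK subsetUr.
- split; first by rewrite R1 setU0 setUCr.
  by rewrite BR ?Ls ?setC0 //; case: (s) s_odd => //= n; rewrite ltnSn.
- move=> k ks ev; have := tr k ks; rewrite (negbTE ev) => E; split=> //.
  by rewrite !BR ?E //; lia.
- move=> k ks od; have := tr k; rewrite od => E; have {}E : Rk k = Rk k.-1 by apply: E; lia.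
  by split=> //; rewrite !BL ?E //; lia.
Qed.

(** * Crossing by means of a set with few neighbours *)

Lemma card_half_split (T : finType) (N : {set T}) m : #|N| <= 2 * m ->
  exists A B : {set T}, [/\ A :|: B = N, [disjoint A & B], #|A| <= m & #|B| <= m].
Proof.
move=> cN; pose A := [set x in take m (enum N)]; pose B := [set x in drop m (enum N)].
have E : enum N = take m (enum N) ++ drop m (enum N) by rewrite cat_take_drop.
exists A, B; split.
- by apply/setP => x; rewrite !inE -mem_cat -E mem_enum.
- rewrite disjoints_subset; apply/subsetP => x; rewrite !inE => xA.
  have := enum_uniq N; rewrite {1}E cat_uniq => /and3P[_ /hasPn h _].
  by apply/negP => /h /=; rewrite xA.
- rewrite cardsE; apply: leq_trans (card_size _) _.
  by rewrite size_take_min geq_minl.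
- rewrite cardsE; apply: leq_trans (card_size _) _.
  by rewrite size_drop -cardE; lia.
Qed.

(** By complements, the load fits as soon as the banks together hold at least [#|X|] vertices. The
    capacity checks of the crossing all take this form. *)
Lemma banks_ok_card (T : finType) (e : rel T) (X L R : {set T}) :
  [disjoint L & R] -> independent e L -> independent e R ->
  #|X| <= #|L| + #|R| -> banks_ok e #|~: X| L R.
Proof.
move=> dj iL iR c; apply/and4P; split=> //.
have := cardsUI L R; move: (dj); rewrite -setI_eq0 => /eqP ->; rewrite cards0.
have := cardsC X; have := cardsC (L :|: R); lia.
Qed.

Section Crossing.
Variables (T : finType) (e : rel T) (e_sym : symmetric e) (X S : {set T}).
Hypotheses (iX : independent e X) (iS : independent e S) (S_gt0 : 0 < #|S|).
Hypothesis (dXS : [disjoint X & S]).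

Let N := [set x in X | [exists y in S, e x y]].

Lemma independent_US (F : {set T}) : F \subset X :\: N -> independent e (S :|: F).
Proof.
move=> /subsetP FX.
have FS x y : x \in F -> y \in S -> ~~ e x y.
  move=> /FX; rewrite !inE => /andP[+ xX] yS; rewrite xX /=.
  by move=> /exists_inPn; apply.
have FF x : x \in F -> x \in X by move=> /FX; rewrite inE => /andP[].
apply/independentP => x y; rewrite !inE => /orP[xS|xF] /orP[yS|yF].
- by have /independentP := iS; apply.
- by rewrite e_sym; apply: FS.
- exact: FS.
- by have /independentP := iX; apply; apply: FF.
Qed.

(** Induction on [#|F|]. While [S] waits on the right, its places on the boat are free, and one
    place suffices to carry the next vertex. *)
Lemma reachable_carry (F : {set T}) :
  F \subset X :\: N -> reachable e #|~: X| (X :\: F) (S :|: F).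
Proof.
have [n] := ubnP #|F|; elim: n F => // n IHn F.
have dXF (A B : {set T}) : B \subset A -> [disjoint X :\: A & S :|: B].
  move=> /subsetP BA; rewrite disjoints_subset; apply/subsetP => x.
  rewrite !inE => /andP[xA xX]; rewrite (disjointFr dXS xX) /=.
  by apply: contra xA => /BA.
have cS (A : {set T}) : A \subset X :\: N -> #|S :|: A| = #|S| + #|A|.
  move=> AX; rewrite cardsU; suff /eqP -> : S :&: A == set0 by rewrite cards0 subn0.
  rewrite setI_eq0 disjoint_sym; apply: disjointWl dXS.
  exact: subset_trans AX (subsetDl _ _).
have cD (A : {set T}) : A \subset X :\: N -> #|X :\: A| + #|A| = #|X|.
  move=> AX; have AX' := subset_trans AX (subsetDl _ _).
  by rewrite cardsDS // subnK // subset_leq_card.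
have iD (A : {set T}) : independent e (X :\: A).
  by apply: independentS iX; apply: subsetDl.
have [->|[a aF]] := set_0Vmem F.
  move=> _ _; rewrite setD0 setU0.
  (* The boat first takes everything outside [X]; then [S] gets off on the right. *)
  apply: (@reachable_step _ _ _ X X set0); last by left.
    apply: reachable_start; apply: banks_ok_card => //.
    - by rewrite disjoint_sym disjoints_subset sub0set.
    - exact: independent0.
    - by rewrite cards0 addn0.
  by apply: banks_ok_card => //; rewrite leq_addr.
move=> cF FX; have cFa := cardsD1 a F; rewrite aF in cFa.
have FaX : F :\ a \subset X :\: N by apply: subset_trans FX; apply: subsetDl.
have {}IHn := IHn (F :\ a) ltac:(lia) FaX.
(* A step changes only one bank: [a] boards on the left here, and is unloaded on the right in the
   next step. *)
have step : reachable e #|~: X| (X :\: F) (S :|: (F :\ a)).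
  apply: reachable_step IHn _ _; last by right.
  apply: banks_ok_card => //; first by apply: dXF; apply: subsetDl.
    exact: independent_US.
  by rewrite cS //; have := cD _ FX; lia.
apply: reachable_step step _ _; last by left.
apply: banks_ok_card => //; first exact: dXF.
  exact: independent_US.
by rewrite cS //; have := cD _ FX; lia.
Qed.

Lemma schedulable_crossing : #|N| <= 2 * #|S| -> schedulable e #|~: X|.
Proof.
move=> /card_half_split [A [B [AB dAB cA cB]]].
have NX : N \subset X by apply/subsetP => x; rewrite inE => /andP[].
pose F := X :\: N.
have AX : A \subset X by apply: subset_trans NX; rewrite -AB subsetUl.
have BX : B \subset X by apply: subset_trans NX; rewrite -AB subsetUr.
have FX : F \subset X by apply: subsetDl.
have dSX : [disjoint S & X] by rewrite disjoint_sym.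
have dFN : [disjoint F & N] by rewrite disjoints_subset /F setDE subsetIr.
have dFA : [disjoint F & A] by apply: disjointWr dFN; rewrite -AB subsetUl.
have dFB : [disjoint F & B] by apply: disjointWr dFN; rewrite -AB subsetUr.
have cU (C D : {set T}) : [disjoint C & D] -> #|C :|: D| = #|C| + #|D|.
  by rewrite cardsU -setI_eq0 => /eqP ->; rewrite cards0 subn0.
have dS (C : {set T}) : C \subset X -> [disjoint S & C].
  by move=> CX; apply: disjointWr dSX.
have cX : #|X| = #|F| + #|A| + #|B|.
  by rewrite -addnA -cU // AB -(cardsID N X) (setIidPr NX) addnC.
have iW (C : {set T}) : C \subset X -> independent e C.
  by move=> CX; apply: independentS iX.
have FAX : F :|: A \subset X by rewrite subUset FX.
have cFA : #|F :|: A| = #|F| + #|A| by apply: cU.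
have dBFA : [disjoint B & F :|: A].
  by rewrite disjoint_sym disjoint_setUl dFB dAB.
have r1 : reachable e #|~: X| N (S :|: F).
  have := @reachable_carry F (subxx _).
  by rewrite /F setDDr setDv set0U (setIidPr NX).
(* [A] boards in the places of [S], by [#|A| <= #|S|]. *)
have r2 : reachable e #|~: X| B (S :|: F).
  apply: reachable_step r1 _ _; last by right.
  apply: banks_ok_card.
  - by rewrite disjoint_sym disjoint_setUl dS.
  - exact: iW.
  - exact: independent_US.
  - by rewrite (cU _ _ (dS _ FX)) cX addnC leq_add2l addnC leq_add2r.
(* [S] and [A] trade places at the right bank; the load is then exactly [~: X]. *)
have r3 : reachable e #|~: X| B (F :|: A).
  apply: reachable_step r2 _ _; last by left.
  apply: banks_ok_card; [done|exact: iW|exact: iW|].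
  by rewrite cFA cX addnC.
(* [S] gets off on the left and [B] boards in its places, by [#|B| <= #|S|]. *)
have r4 : reachable e #|~: X| S (F :|: A).
  apply: reachable_step r3 _ _; last by right.
  apply: banks_ok_card; [exact: dS|done|exact: iW|].
  by rewrite cFA cX addnC leq_add2r.
have r5 : reachable e #|~: X| S X.
  apply: reachable_step r4 _ _; last by left.
  by apply: banks_ok_card => //; rewrite leq_addl.
(* Finally [S] boards, which empties the left bank. *)
apply: (@reachable_schedulable _ _ _ X); apply: reachable_step r5 _ _; last by right.
apply: banks_ok_card => //; last by rewrite leq_addl.
  by rewrite disjoints_subset sub0set.
exact: independent0.
Qed.

End Crossing.

(** * Weighted greedy choice and edge counting *)

(** Choose [v] of maximal weight and delete its closed neighbourhood [D] in [U]: the weight lost is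
    at most [w v * #|D| <= c]. The hypothesis survives on [U :\: D], where degrees can only drop. *)
Lemma greedy_independent (T : finType) (e : rel T) (e_sym : symmetric e)
    (e_irr : irreflexive e) (w : T -> nat) c (U : {set T}) :
  {in U, forall v, w v * #|[set u in U | e v u]|.+1 <= c} ->
  exists S : {set T},
    [/\ S \subset U, independent e S & \sum_(v in U) w v <= c * #|S|].
Proof.
have [n] := ubnP #|U|; elim: n U => // n IHn U cU wU.
have [U0|[u uU]] := set_0Vmem U.
  by exists set0; rewrite U0 sub0set independent0 big_set0.
pose v := [arg max_(v > u in U) w v].
have [vU vmax] : v \in U /\ {in U, forall x, w x <= w v}.
  by rewrite /v; case: arg_maxnP.
pose D := v |: [set u in U | e v u].
have DU : D \subset U.
  by rewrite subUset sub1set vU; apply/subsetP => x; rewrite inE => /andP[].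
have [||S [SU iS cS]] := IHn (U :\: D).
- have := cardsD1 v U; rewrite vU => cUv.
  have : #|U :\: D| <= #|U :\ v| by apply/subset_leq_card/setDS; rewrite sub1set setU11.
  lia.
- move=> x; rewrite inE => /andP[_ xU]; apply: leq_trans (wU x xU).
  rewrite leq_mul2l ltnS; apply/orP; right; apply/subset_leq_card/subsetP => y.
  by rewrite !inE -andbA => /and3P[_ -> ->].
have vS y : y \in S -> ~~ e v y && (y != v).
  move=> /(subsetP SU); rewrite !inE => /andP[+ yU]; rewrite yU negb_or /=.
  by rewrite andbC.
exists (v |: S); split.
- by rewrite subUset sub1set vU; apply: subset_trans SU _; apply: subsetDl.
- apply/independentP => x y; rewrite !inE => /orP[/eqP->|xS] /orP[/eqP->|yS].
  + by rewrite e_irr.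
  + by have /andP[] := vS y yS.
  + by rewrite e_sym; have /andP[] := vS x xS.
  + by have /independentP := iS; apply.
- have vNS : v \notin S by apply/negP => /vS; rewrite eqxx andbF.
  rewrite cardsU1 vNS mulnDr muln1 (big_setID D) /= (setIidPr DU) leq_add //.
  apply: leq_trans (wU v vU).
  have <- : #|D| = #|[set u in U | e v u]|.+1 by rewrite cardsU1 inE e_irr andbF.
  rewrite mulnC -sum_nat_const; apply: leq_sum => x xD.
  by apply: vmax; apply: (subsetP DU).
Qed.

(** Double counting of the edges between [X] and its complement: as [X] is independent, all [r]
    edges at a vertex of [X] leave [X]. *)
Lemma sum_nbrs_cover (T : finType) (e : rel T) (e_sym : symmetric e) (r : nat)
    (e_reg : regular e r) (X : {set T}) : independent e X ->
  \sum_(y in ~: X) #|[set x in X | e y x]| = #|X| * r.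
Proof.
move=> /independentP iX.
rewrite -sum_nat_const -(eq_bigr _ (fun x _ => e_reg x)).
under eq_bigr => y _ do rewrite -sum1dep_card.
under [RHS]eq_bigr => x _ do rewrite -sum1dep_card.
rewrite (exchange_big_dep (mem X)) /=; last by move=> y x _ /andP[].
apply: eq_bigr => x xX; apply: eq_bigl => y; rewrite !inE xX e_sym /=.
by have [yX|] := boolP (y \in X) => //=; rewrite (negbTE (iX x y xX yX)).
Qed.

Lemma schedulable_regular (T : finType) (e : rel T) (e_sym : symmetric e)
    (e_irr : irreflexive e) (r : nat) (r_in : r \in [:: 2; 3; 4; 5])
    (e_reg : regular e r) (X : {set T}) :
  independent e X -> 0 < #|~: X| -> schedulable e #|~: X|.
Proof.
move=> iX Y_gt0.
have nbrX (S : {set T}) :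
    [set x in X | [exists y in S, e x y]] \subset X.
  by apply/subsetP => x; rewrite inE => /andP[].
have [/exists_inP[y yY dy]|] :=
    boolP [exists y in ~: X, #|[set x in X | e y x]| <= 2].
  apply: (@schedulable_crossing _ _ e_sym X [set y]) => //.
  - by apply/independentP => a b; rewrite !inE => /eqP-> /eqP->; rewrite e_irr.
  - by rewrite cards1.
  - by rewrite disjoint_sym disjoints1 -in_setC.
  rewrite cards1; apply: leq_trans dy; apply/subset_leq_card/subsetP => x.
  rewrite !inE => /andP[-> /exists_inP[z]]; rewrite inE => /eqP ->.
  by rewrite e_sym.
move=> /exists_inPn d3.
have [|S [SY iS]] := @greedy_independent _ _ e_sym e_irr
    (fun y => #|[set x in X | e y x]|) (2 * r) (~: X).
  move=> y yY; have := d3 y yY; rewrite -ltnNge.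
  have : #|[set x in X | e y x]| + #|[set x in ~: X | e y x]| = r.
    rewrite -(e_reg y) -(cardsID X [set z | e y z]).
    by congr (_ + _); apply: eq_card => x; rewrite !inE andbC.
  (* With [d + m = r] and [d >= 3] the goal is [d * m.+1 <= 2 * r]. The tightest case is [r = 5],
     [d = 3], giving 9 against 10; [r = 2] is vacuous. *)
  move: r_in (#|[set x in X | _]|) (#|[set x in ~: X | _]|).
  by rewrite !inE => /or4P[] /eqP -> d m; nia.
rewrite (sum_nbrs_cover e_sym e_reg iX) => cS.
have r_gt0 : 0 < r by move: r_in; rewrite !inE => /or4P[] /eqP ->.
have {}cS : #|X| <= 2 * #|S| by nia.
have dXS : [disjoint X & S] by rewrite disjoint_sym disjoints_subset.
apply: (@schedulable_crossing _ _ e_sym X S) => //.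
  (* A vertex outside [X] has at least 3 neighbours in [X], so [X] is nonempty and
     [#|X| <= 2 * #|S|] forces [S] to be nonempty. *)
  have [y yY] : exists y, y \in ~: X by apply/card_gt0P.
  have := d3 y yY; rewrite -ltnNge => d3y.
  have : #|[set x in X | e y x]| <= #|X|.
    by apply/subset_leq_card/subsetP => x; rewrite inE => /andP[].
  lia.
by apply: leq_trans cS; apply: subset_leq_card.
Qed.

Theorem theorem3p9 (T : finType) (e : rel T) (e_sym : symmetric e)
    (e_irr : irreflexive e) (T_gt0 : 0 < #|T|) (r : nat)
    (r_in : r \in [:: 2; 3; 4; 5]) (e_reg : regular e r) :
  class_one e.
Proof.
rewrite /class_one /alcuin_number; case: ex_minnP => m /andP[_ /asboolP sched] minm.
apply/eqP; rewrite eqn_leq (schedulable_cover sched) andbT.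
have [Y [cY <-] _] := vertex_cover_numberP e.
(* Capacities must be positive: there is an edge, because [r > 0], and [Y] contains one of its
   ends. *)
have Y_gt0 : 0 < #|Y|.
  have [x _] : exists x : T, x \in T by apply/card_gt0P.
  have /card_gt0P [y] : 0 < #|[set y | e x y]|.
    by rewrite e_reg; move: r_in; rewrite !inE => /or4P[] /eqP ->.
  rewrite inE => exy; apply/card_gt0P.
  have /forallP/(_ x)/forallP/(_ y) := cY; rewrite exy.
  by case/orP => ?; [exists x|exists y].
apply: minm; rewrite Y_gt0; apply/asboolP; rewrite -[Y]setCK.
by apply: (schedulable_regular e_sym e_irr r_in e_reg);
  rewrite ?setCK // -vertex_coverC.
Qed.
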